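(* Let $(A,\cdot,D,Q)$ be an admissible commutative differential algebra and, for $q\in\mathbf{k}$, let $(A,\circ_q)$ be the induced Novikov algebra, $a\circ_q b=a\cdot(D+qQ)(b)$. Let $r\in A\otimes A$ be an antisymmetric solution of the admissible associative Yang-Baxter equation in $(A,\cdot,D,Q)$. Define linear maps $A\to A\otimes A$ by $$\delta_r(a)=(\mathrm{id}\otimes L_\cdot(a)-L_\cdot(a)\otimes\mathrm{id})r,\quad \Delta_q(a)=-(\mathrm{id}\otimes(Q+qD))\delta_r(a),\quad \Delta_{q,r}(a)=(L_{\circ_q}(a)\otimes\mathrm{id}+\mathrm{id}\otimes L_{\star_q}(a))r,$$ where $a\star_q b=a\circ_q b+b\circ_q a$ (so $\Delta_q$ is obtained from the commutative and cocommutative differential ASI bialgebra $(A,\cdot,-\delta_r,D,Q)$, while $\Delta_{q,r}$ is the coboundary coproduct attached to $r$ as a solution of the Novikov Yang-Baxter equation). Then: (a) The two Novikov bialgebras $(A,\circ_{-\frac12},\Delta_{-\frac12,r})$ and $(A,\circ_{-\frac12},\Delta_{-\frac12})$ coincide. (b) Suppose that $Q$ is a derivation on $(A,\cdot)$. Then for each $q\in\mathbf{k}$, the two Novikov bialgebras $(A,\circ_q,\Delta_{q,r})$ and $(A,\circ_q,\Delta_q)$ coincide.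
   Context: $\mathbf{k}$ is a field of characteristic $0$; all vector spaces are over $\mathbf{k}$ and finite-dimensional. $\tau(a\otimes b)=b\otimes a$; $L_*(a)b=a*b$, $R_*(a)b=b*a$. Admissible commutative differential algebra $(A,\cdot,D,Q)$: $(A,\cdot)$ commutative associative, $D,Q:A\to A$ linear, $D(a\cdot b)=D(a)\cdot b+a\cdot D(b)$, $Q(a\cdot b)=Q(a)\cdot b-a\cdot D(b)$. For $r=\sum_i x_i\otimes y_i$ set $r_{13}\cdot r_{23}=\sum_{i,j}x_i\otimes x_j\otimes y_i\cdot y_j$, $r_{12}\cdot r_{23}=\sum_{i,j}x_i\otimes y_i\cdot x_j\otimes y_j$, $r_{13}\cdot r_{12}=\sum_{i,j}x_i\cdot x_j\otimes y_j\otimes y_i$. A solution of the admissible associative Yang-Baxter equation in $(A,\cdot,D,Q)$ is $r\in A\otimes A$ with $r_{13}\cdot r_{12}+r_{13}\cdot r_{23}-r_{12}\cdot r_{23}=0$, $(D\otimes\mathrm{id}-\mathrm{id}\otimes Q)(r)=0$ and $(\mathrm{id}\otimes D-Q\otimes\mathrm{id})(r)=0$. Antisymmetric means $\tau(r)=-r$. Novikov algebra $(A,\circ)$: $(a\circ b)\circ c-a\circ(b\circ c)=(b\circ a)\circ c-b\circ(a\circ c)$, $(a\circ b)\circ c=(a\circ c)\circ b$; $a\star b=a\circ b+b\circ a$. Novikov coalgebra $(A,\Delta)$: $(\mathrm{id}\otimes\Delta)\Delta(a)-(\tau\otimes\mathrm{id})(\mathrm{id}\otimes\Delta)\Delta(a)=(\Delta\otimes\mathrm{id})\Delta(a)-(\tau\otimes\mathrm{id})(\Delta\otimes\mathrm{id})\Delta(a)$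 and $(\tau\otimes\mathrm{id})(\mathrm{id}\otimes\Delta)\tau\Delta(a)=(\Delta\otimes\mathrm{id})\Delta(a)$. Novikov bialgebra $(A,\circ,\Delta)$: Novikov algebra and Novikov coalgebra with, for all $a,b$: $\Delta(a\circ b)=(R_\circ(b)\otimes\mathrm{id})\Delta(a)+(\mathrm{id}\otimes L_\star(a))(\Delta(b)+\tau\Delta(b))$; $(L_\star(a)\otimes\mathrm{id})\Delta(b)-(\mathrm{id}\otimes L_\star(a))\tau\Delta(b)=(L_\star(b)\otimes\mathrm{id})\Delta(a)-(\mathrm{id}\otimes L_\star(b))\tau\Delta(a)$; $(\mathrm{id}\otimes R_\circ(a)-R_\circ(a)\otimes\mathrm{id})(\Delta(b)+\tau\Delta(b))=(\mathrm{id}\otimes R_\circ(b)-R_\circ(b)\otimes\mathrm{id})(\Delta(a)+\tau\Delta(a))$. In case (a), and in case (b) for every $q$, both triples in question are Novikov bialgebras. *)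

(* Defs.v *)
From HB Require Import structures.
From mathcomp Require Import all_boot all_order all_algebra.

Set Implicit Arguments.
Unset Strict Implicit.
Unset Printing Implicit Defensive.

Import GRing.Theory.
Local Open Scope ring_scope.

Reserved Notation "U ⊗ V" (at level 40, left associativity).

(* MathComp has no tensor product of abstract vector spaces. We represent
   U ⊗ V by coordinate matrices in the bases vbasis {:U} and vbasis {:V};
   pure_tensor_bilinear, tlift_pure and tlift_unique state the universal
   property, which characterizes it independently of these bases. *)
Definition tensor (K : fieldType) (U V : vectType K) : Type :=
  'M[K]_(\dim {:U}, \dim {:V}).

Arguments tensor {K} (U V)%_type.
Notation "U ⊗ V" := (tensor U V) : type_scope.

HB.instance Definition _ (K : fieldType) (U V : vectType K) :=
  Vector.copy (tensor U V) 'M[K]_(\dim {:U}, \dim {:V}).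

Definition is_bilinear (K : fieldType) (U V W : vectType K)
    (f : U -> V -> W) : Prop :=
  (forall u, linear (f u)) /\ (forall v, linear (fun u => f u v)).

Section Tensor.

Variable K : fieldType.

Definition pure_tensor (U V : vectType K) (u : U) (v : V) : U ⊗ V :=
  \matrix_(i, j) (coord (vbasis {:U}) i u * coord (vbasis {:V}) j v).

(* The linear map on U ⊗ V induced by a bilinear map f. The formula makes
   sense for any f, but is only meaningful when f is bilinear. *)
Definition tlift (U V W : vectType K) (f : U -> V -> W) (t : U ⊗ V) : W :=
  \sum_i \sum_j t i j *: f (vbasis {:U})`_i (vbasis {:V})`_j.

End Tensor.

Notation "u ⊗ v" := (pure_tensor u v) : ring_scope.

Section TensorTheory.

Variables (K : fieldType) (U V W : vectType K).

Lemma pure_tensor_bilinear : is_bilinear (@pure_tensor K U V).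
Proof.
split=> [u|v] a x y; apply/matrixP=> i j; rewrite !mxE linearP /=.
  by rewrite mulrDr mulrCA.
by rewrite mulrDl mulrA.
Qed.

Lemma tlift_linear (f : U -> V -> W) : linear (tlift f).
Proof.
move=> a s t; rewrite /tlift scaler_sumr -big_split; apply: eq_bigr => i _.
rewrite scaler_sumr -big_split; apply: eq_bigr => j _ /=.
by rewrite !mxE scalerDl scalerA.
Qed.

Lemma tlift_pure (f : U -> V -> W) u v :
  is_bilinear f -> tlift f (u ⊗ v) = f u v.
Proof.
case=> lin_r lin_l.
pose fr x := GRing.isLinear.Build K V W *:%R (f x) (lin_r x).
pose Fr x : {linear V -> W} := HB.pack (f x) (fr x).
pose fl y := GRing.isLinear.Build K U W *:%R (fun x => f x y) (lin_l y).
pose Fl y : {linear U -> W} := HB.pack (fun x => f x y) (fl y).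
have fE x : f u x = Fl x u by [].
rewrite [v in RHS](coord_vbasis (memvf v)).
rewrite -[f u _]/(Fr u _) linear_sum /tlift exchange_big /=.
apply: eq_bigr => j _; rewrite -[f u _]/(Fr u _) linearZ /= fE.
rewrite {2}(coord_vbasis (memvf u)) linear_sum scaler_sumr.
by apply: eq_bigr => i _; rewrite mxE linearZ /= scalerA mulrC.
Qed.

Lemma tensor_expand (t : U ⊗ V) :
  t = \sum_i \sum_j t i j *: ((vbasis {:U})`_i ⊗ (vbasis {:V})`_j).
Proof.
pose e (i : 'I_(\dim {:U})) (j : 'I_(\dim {:V})) : 'M[K]_(\dim {:U}, \dim {:V}) :=
  (vbasis {:U})`_i ⊗ (vbasis {:V})`_j.
change ((t : 'M_(_, _)) = \sum_i \sum_j t i j *: e i j).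
have eE i j k l : e i j k l = (i == k)%:R * (j == l)%:R.
  by rewrite !mxE !coord_free ?(basis_free (vbasisP _)) //.
apply/matrixP=> k l; rewrite summxE (bigD1 k) //= [X in _ + X]big1 ?addr0.
  rewrite summxE (bigD1 l) //= [X in _ + X]big1 ?addr0.
    by rewrite mxE eE !eqxx !mulr1.
  by move=> j /negPf njl; rewrite mxE eE njl !mulr0.
move=> i /negPf nik; rewrite summxE big1 // => j _.
by rewrite mxE eE nik mul0r mulr0.
Qed.

Lemma tlift_unique (f : U -> V -> W) (g : U ⊗ V -> W) :
  linear g -> (forall u v, g (u ⊗ v) = f u v) -> g =1 tlift f.
Proof.
move=> g_lin gE t.
pose gl := GRing.isLinear.Build K (U ⊗ V)%type W *:%R g g_lin.
pose G : {linear (U ⊗ V)%type -> W} := HB.pack g gl.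
rewrite {1}(tensor_expand t) -[g _]/(G _) linear_sum.
apply: eq_bigr => i _; rewrite linear_sum.
by apply: eq_bigr => j _; rewrite linearZ /= gE.
Qed.

Lemma tlift_sum (n : nat) (f : U -> V -> W) (x : 'I_n -> U) (y : 'I_n -> V) :
  is_bilinear f ->
  tlift f (\sum_i (x i ⊗ y i : U ⊗ V)) = \sum_i f (x i) (y i).
Proof.
move=> f_bilin.
pose fl := GRing.isLinear.Build K (U ⊗ V)%type W *:%R (tlift f) (tlift_linear f).
pose F : {linear (U ⊗ V)%type -> W} := HB.pack (tlift f) fl.
rewrite -[LHS]/(F _) linear_sum.
by apply: eq_bigr => i _; rewrite /= tlift_pure.
Qed.

Lemma tlift2_sum (n : nat) (f : U -> V -> U -> V -> W)
    (x : 'I_n -> U) (y : 'I_n -> V) (r : U ⊗ V) :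
  (forall u v, is_bilinear (f u v)) ->
  (forall u' v', is_bilinear (fun u v => f u v u' v')) ->
  r = \sum_i (x i ⊗ y i : U ⊗ V) ->
  tlift (fun u v => tlift (f u v) r) r
    = \sum_i \sum_j f (x i) (y i) (x j) (y j).
Proof.
move=> f_bil1 f_bil2 rE; rewrite {2}rE tlift_sum.
  by apply: eq_bigr => i _; rewrite rE tlift_sum.
by split=> w a s t; rewrite rE !tlift_sum // scaler_sumr -big_split;
  apply: eq_bigr => i _; have [lr ll] := f_bil2 (x i) (y i);
  [exact: lr | exact: ll].
Qed.

End TensorTheory.

Section TensorMaps.

Variable K : fieldType.
Implicit Types U V W : vectType K.

Definition tmap U V U' V' (f : U -> U') (g : V -> V') : U ⊗ V -> U' ⊗ V' :=
  tlift (fun u v => f u ⊗ g v).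

Definition tau U V : U ⊗ V -> V ⊗ U := tlift (fun u v => v ⊗ u).

(* All triple tensor products are compared in (U ⊗ V) ⊗ W. *)
Definition tassoc U V W : U ⊗ (V ⊗ W) -> U ⊗ V ⊗ W :=
  tlift (fun u t => tlift (fun v w => u ⊗ v ⊗ w) t).

End TensorMaps.

Section Algebras.

Variables (k : fieldType) (A : vectType k).

Definition opL (op : A -> A -> A) (a b : A) : A := op a b.
Definition opR (op : A -> A -> A) (a b : A) : A := op b a.

Definition is_derivation (mul : A -> A -> A) (D : A -> A) : Prop :=
  forall a b, D (mul a b) = mul (D a) b + mul a (D b).

Record is_comm_assoc_algebra (mul : A -> A -> A) : Prop := {
  caa_bilinear : is_bilinear mul;
  caa_comm : commutative mul;
  caa_assoc : associative mul
}.

Record is_adm_comm_diff_algebra (mul : A -> A -> A) (D Q : A -> A) : Prop := {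
  acda_algebra : is_comm_assoc_algebra mul;
  acda_D_linear : linear D;
  acda_Q_linear : linear Q;
  acda_D_derivation : is_derivation mul D;
  acda_Q_admissible : forall a b, Q (mul a b) = mul (Q a) b - mul a (D b)
}.

Section YangBaxter.

Variables (mul : A -> A -> A) (D Q : A -> A) (r : A ⊗ A).

(* Here x ⊗ y and x' ⊗ y' stand for the generic terms x_i ⊗ y_i and
   x_j ⊗ y_j of two copies of r. *)
Definition r13r23 : A ⊗ A ⊗ A :=
  tlift (fun x y => tlift (fun x' y' => x ⊗ x' ⊗ mul y y') r) r.

Definition r12r23 : A ⊗ A ⊗ A :=
  tlift (fun x y => tlift (fun x' y' => x ⊗ mul y x' ⊗ y') r) r.

Definition r13r12 : A ⊗ A ⊗ A :=
  tlift (fun x y => tlift (fun x' y' => mul x x' ⊗ y' ⊗ y) r) r.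

Lemma r13r23_sum n (x y : 'I_n -> A) :
  is_bilinear mul -> r = \sum_i (x i ⊗ y i : A ⊗ A) ->
  r13r23 = \sum_i \sum_j (x i ⊗ x j ⊗ mul (y i) (y j) : A ⊗ A ⊗ A).
Proof.
move=> [mulr mull] rE.
have [tr tl] := @pure_tensor_bilinear k A A.
have [ttr ttl] := @pure_tensor_bilinear k (A ⊗ A)%type A.
apply: tlift2_sum rE => [u v|u' v']; split=> w a s t.
- by rewrite mulr ttr.
- by rewrite tr ttl.
- by rewrite mull ttr.
- by rewrite tl ttl.
Qed.

Lemma r12r23_sum n (x y : 'I_n -> A) :
  is_bilinear mul -> r = \sum_i (x i ⊗ y i : A ⊗ A) ->
  r12r23 = \sum_i \sum_j (x i ⊗ mul (y i) (x j) ⊗ y j : A ⊗ A ⊗ A).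
Proof.
move=> [mulr mull] rE.
have [tr tl] := @pure_tensor_bilinear k A A.
have [ttr ttl] := @pure_tensor_bilinear k (A ⊗ A)%type A.
apply: tlift2_sum rE => [u v|u' v']; split=> w a s t.
- by rewrite ttr.
- by rewrite mulr tr ttl.
- by rewrite mull tr ttl.
- by rewrite tl ttl.
Qed.

Lemma r13r12_sum n (x y : 'I_n -> A) :
  is_bilinear mul -> r = \sum_i (x i ⊗ y i : A ⊗ A) ->
  r13r12 = \sum_i \sum_j (mul (x i) (x j) ⊗ y j ⊗ y i : A ⊗ A ⊗ A).
Proof.
move=> [mulr mull] rE.
have [tr tl] := @pure_tensor_bilinear k A A.
have [ttr ttl] := @pure_tensor_bilinear k (A ⊗ A)%type A.
apply: tlift2_sum rE => [u v|u' v']; split=> w a s t.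
- by rewrite tr ttl.
- by rewrite mulr tl ttl.
- by rewrite ttr.
- by rewrite mull tl ttl.
Qed.

Record is_adm_aybe_solution : Prop := {
  aybe_eq : r13r12 + r13r23 - r12r23 = 0;
  aybe_DQ : tmap D id r - tmap id Q r = 0;
  aybe_QD : tmap id D r - tmap Q id r = 0
}.

Definition is_antisymmetric_tensor : Prop := tau r = - r.

End YangBaxter.

Definition star (circ : A -> A -> A) (a b : A) : A := circ a b + circ b a.

Record is_novikov_algebra (circ : A -> A -> A) : Prop := {
  nov_bilinear : is_bilinear circ;
  nov_left_symmetric : forall a b c,
    circ (circ a b) c - circ a (circ b c)
      = circ (circ b a) c - circ b (circ a c);
  nov_right_comm : forall a b c, circ (circ a b) c = circ (circ a c) b
}.

Record is_novikov_coalgebra (Delta : A -> A ⊗ A) : Prop := {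
  conov_linear : linear Delta;
  conov_left_symmetric : forall a,
    let t := tassoc (tmap id Delta (Delta a)) in
    let s := tmap Delta id (Delta a) in
    t - tmap (@tau k A A) id t = s - tmap (@tau k A A) id s;
  conov_right_comm : forall a,
    tmap (@tau k A A) id (tassoc (tmap id Delta (tau (Delta a))))
      = tmap Delta id (Delta a)
}.

Record is_novikov_bialgebra
    (circ : A -> A -> A) (Delta : A -> A ⊗ A) : Prop := {
  binov_algebra : is_novikov_algebra circ;
  binov_coalgebra : is_novikov_coalgebra Delta;
  binov_compat1 : forall a b,
    Delta (circ a b)
      = tmap (opR circ b) id (Delta a)
        + tmap id (opL (star circ) a) (Delta b + tau (Delta b));
  binov_compat2 : forall a b,
    tmap (opL (star circ) a) id (Delta b)
        - tmap id (opL (star circ) a) (tau (Delta b))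
      = tmap (opL (star circ) b) id (Delta a)
        - tmap id (opL (star circ) b) (tau (Delta a));
  binov_compat3 : forall a b,
    tmap id (opR circ a) (Delta b + tau (Delta b))
        - tmap (opR circ a) id (Delta b + tau (Delta b))
      = tmap id (opR circ b) (Delta a + tau (Delta a))
        - tmap (opR circ b) id (Delta a + tau (Delta a))
}.

Section Induced.

Variables (mul : A -> A -> A) (D Q : A -> A) (q : k) (r : A ⊗ A).

Definition circq (a b : A) : A := mul a (D b + q *: Q b).

Definition delta_r (a : A) : A ⊗ A :=
  tmap id (opL mul a) r - tmap (opL mul a) id r.

Definition Delta_q (a : A) : A ⊗ A :=
  - tmap id (fun b => Q b + q *: D b) (delta_r a).

Definition Delta_qr (a : A) : A ⊗ A :=
  tmap (opL circq a) id r + tmap id (opL (star circq) a) r.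

End Induced.

End Algebras.

(* Main.v *)
(* Put E = Q + D. Admissibility makes E linear over A, and the defining
   relations of r become P x ⊗ y = x ⊗ dl y for dl = D + q Q and P = Q + q D.
   In both cases (1 + 2q) E(a) b = 0: for q = -1/2 the scalar vanishes, and if
   Q is a derivation then E(a) b = 0. This amounts to P (a b) = - a ⋆_q b, so
   both coproducts are equal to Δ(a) = a x ⊗ P y - x ⊗ P (a y). The compatibility
   conditions of this Δ with a ∘ b = a (dl b) reduce to the commutativity of A,
   and the coalgebra axioms follow from the Yang-Baxter equation with P and the
   multiplication by a applied to some of its tensor factors. *)
Require Import Defs.
From HB Require Import structures.
From mathcomp Require Import all_boot all_order all_algebra.
Import GRing.Theory.
Local Open Scope ring_scope.

Set Implicit Arguments.
Unset Strict Implicit.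
Unset Printing Implicit Defensive.

(** * Tensor calculus: linear maps on tensors and their values on sums of pure tensors *)

HB.instance Definition _ (K : fieldType) (U V W : vectType K)
    (f : U -> V -> W) :=
  GRing.isLinear.Build K (U ⊗ V)%type W *:%R (tlift f) (tlift_linear f).

HB.instance Definition _ (K : fieldType) (U V U' V' : vectType K)
    (f : U -> U') (g : V -> V') :=
  GRing.isLinear.Build K (U ⊗ V)%type (U' ⊗ V')%type *:%R (tmap f g)
    (tlift_linear _).

HB.instance Definition _ (K : fieldType) (U V : vectType K) :=
  GRing.isLinear.Build K (U ⊗ V)%type (V ⊗ U)%type *:%R (@tau K U V)
    (tlift_linear _).

HB.instance Definition _ (K : fieldType) (U V W : vectType K) :=
  GRing.isLinear.Build K (U ⊗ (V ⊗ W))%type (U ⊗ V ⊗ W)%type *:%R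
    (@tassoc K U V W) (tlift_linear _).

Section TensorCalculus.

Variable K : fieldType.
Implicit Types U V W : vectType K.

Lemma pure_tensorPr U V (u : U) : linear (pure_tensor u : V -> (U ⊗ V)%type).
Proof. by have [] := @pure_tensor_bilinear K U V. Qed.

Lemma pure_tensorPl U V (v : V) : linear ((pure_tensor (V:=V))^~ v : U -> _).
Proof. by have [] := @pure_tensor_bilinear K U V. Qed.

Lemma pure_tensorDl U V (u1 u2 : U) (v : V) :
  (u1 + u2) ⊗ v = u1 ⊗ v + u2 ⊗ v.
Proof. by have /= := pure_tensorPl v 1 u1 u2; rewrite !scale1r. Qed.

Lemma pure_tensor0l U V (v : V) : 0 ⊗ v = 0 :> U ⊗ V.
Proof. by apply: (addrI (0 ⊗ v)); rewrite -pure_tensorDl !addr0. Qed.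

Lemma pure_tensorNl U V (u : U) (v : V) : (- u) ⊗ v = - (u ⊗ v).
Proof. by apply/eqP; rewrite -addr_eq0 -pure_tensorDl addNr pure_tensor0l. Qed.

Lemma pure_tensor_suml (I : finType) U V (u : I -> U) (v : V) :
  (\sum_i u i) ⊗ v = \sum_i (u i ⊗ v).
Proof.
by elim/big_rec2: _ => [|i s t _ <-]; rewrite (pure_tensor0l, pure_tensorDl).
Qed.

HB.instance Definition _ U V (u : U) :=
  GRing.isLinear.Build K V (U ⊗ V)%type *:%R (pure_tensor u)
    (@pure_tensorPr U V u).

Lemma pure_tensorDr U V (u : U) (v1 v2 : V) :
  u ⊗ (v1 + v2) = u ⊗ v1 + u ⊗ v2.
Proof. exact: linearD. Qed.

Lemma pure_tensorNr U V (u : U) (v : V) : u ⊗ (- v) = - (u ⊗ v).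
Proof. exact: linearN. Qed.

Lemma pure_tensor_sumr (I : finType) U V (u : U) (v : I -> V) :
  u ⊗ (\sum_i v i) = \sum_i (u ⊗ v i).
Proof. exact: linear_sum. Qed.

Lemma tmap_pure U V U' V' (f : U -> U') (g : V -> V') u v :
  linear f -> linear g -> tmap f g (u ⊗ v) = f u ⊗ g v.
Proof.
move=> lf lg; rewrite /tmap tlift_pure //.
by split=> w a s t; rewrite ?lf ?lg ?pure_tensorPr ?pure_tensorPl.
Qed.

Lemma tmap_sum (I : finType) U V U' V' (f : U -> U') (g : V -> V') u v :
  linear f -> linear g ->
  tmap f g (\sum_(i : I) (u i ⊗ v i : U ⊗ V)) = \sum_i (f (u i) ⊗ g (v i)).
Proof.
by move=> lf lg; rewrite linear_sum; apply: eq_bigr => i _; apply: tmap_pure.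
Qed.

Lemma tmap3_sum (I J : finType) U V W U' V' W'
    (f : U -> U') (g : V -> V') (h : W -> W') u v w :
  linear f -> linear g -> linear h ->
  tmap (tmap f g) h
      (\sum_(i : I) \sum_(j : J) (u i j ⊗ v i j ⊗ w i j : U ⊗ V ⊗ W)) =
    \sum_i \sum_j (f (u i j) ⊗ g (v i j) ⊗ h (w i j) : U' ⊗ V' ⊗ W').
Proof.
move=> lf lg lh; rewrite linear_sum; apply: eq_bigr => i _ /=.
rewrite tmap_sum //; last exact: linearP.
by apply: eq_bigr => j _; rewrite tmap_pure.
Qed.

Lemma tau_pure U V (u : U) (v : V) : tau (u ⊗ v) = v ⊗ u.
Proof.
rewrite /tau tlift_pure //.
by split=> w a s t; rewrite ?pure_tensorPr ?pure_tensorPl.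
Qed.

Lemma tau_sum (I : finType) U V u v :
  tau (\sum_(i : I) (u i ⊗ v i : U ⊗ V)) = \sum_i (v i ⊗ u i).
Proof.
by rewrite linear_sum; apply: eq_bigr => i _; apply: tau_pure.
Qed.

Lemma tassoc_pure U V W (u : U) (v : V) (w : W) :
  tassoc (u ⊗ (v ⊗ w)) = u ⊗ v ⊗ w.
Proof.
rewrite /tassoc !tlift_pure //; split=> z a s t.
- by rewrite !(pure_tensorPr, pure_tensorPl).
- by rewrite !(pure_tensorPr, pure_tensorPl).
- exact: linearP.
(* In this goal the variable sits in the lifted map, not in the tensor, so linearity is checked on
   coordinates. *)
- rewrite /tlift scaler_sumr -big_split; apply: eq_bigr => i _.
  rewrite scaler_sumr -big_split; apply: eq_bigr => j _ /=.
  by rewrite !pure_tensorPl scalerDr !scalerA [_ * a]mulrC.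
Qed.

(** Collecting each row of the coordinate matrix into one vector leaves a single index, as in the
    usual notation for [r]. *)
Lemma tensor_decomposition U V (t : U ⊗ V) :
  exists x : 'I_(\dim {:U}) -> U, exists y : 'I_(\dim {:U}) -> V,
    t = \sum_i (x i ⊗ y i : U ⊗ V).
Proof.
exists (fun i => (vbasis {:U})`_i).
exists (fun i => \sum_j t i j *: (vbasis {:V})`_j).
rewrite [LHS]tensor_expand; apply: eq_bigr => i _.
by rewrite linear_sum; apply: eq_bigr => j _; rewrite linearZ.
Qed.

End TensorCalculus.

(** * Novikov bialgebra built from [P], [dl], [dd] and an antisymmetric Yang-Baxter solution *)

Section CoboundaryBialgebra.

Variables (k : fieldType) (A : vectType k) (mul : A -> A -> A).
Hypothesis mul_alg : is_comm_assoc_algebra mul.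
(* In the application P = Q + q D, dl = D + q Q and dd = (1 - q) D. *)
Variables P dl dd : {linear A -> A}.
Hypothesis P_mul : forall a b, P (mul a b) = mul (P a) b - mul a (dd b).
Hypothesis dl_mul : forall a b, dl (mul a b) = mul a (dl b) + mul (dd a) b.
Hypothesis P_star : forall a b, P (mul a b) = - (mul a (dl b) + mul b (dl a)).

Variables (n : nat) (x y : 'I_n -> A) (r : A ⊗ A).
Hypothesis rE : r = \sum_i (x i ⊗ y i : A ⊗ A).
Hypothesis r_antisym : is_antisymmetric_tensor r.
Hypothesis r_aybe : r13r12 mul r + r13r23 mul r - r12r23 mul r = 0.
Hypothesis r_shift : tmap P id r = tmap id dl r.

Variables (circ : A -> A -> A) (Delta : A -> A ⊗ A).
Hypothesis circE : forall a b, circ a b = mul a (dl b).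
Hypothesis DeltaE : forall a,
  Delta a = tmap (mul a) P r - tmap id (fun b => P (mul a b)) r.

Let mulC : commutative mul := caa_comm mul_alg.
Let mulA : associative mul := caa_assoc mul_alg.

Let mulPr a : linear (mul a).
Proof. by case: (caa_bilinear mul_alg). Qed.

Let mulPl b : linear (mul^~ b).
Proof. by case: (caa_bilinear mul_alg). Qed.

Let mulDl a b c : mul (a + b) c = mul a c + mul b c.
Proof. by have /= := mulPl c 1 a b; rewrite !scale1r. Qed.

Let mulDr a b c : mul c (a + b) = mul c a + mul c b.
Proof. by rewrite !(mulC c) mulDl. Qed.

Let mulNl a c : mul (- a) c = - mul a c.
Proof.
have mul0 : mul 0 c = 0 by apply: (addrI (mul 0 c)); rewrite -mulDl !addr0.
by apply/eqP; rewrite -addr_eq0 -mulDl addNr mul0.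
Qed.

Let mulCA a b c : mul a (mul b c) = mul b (mul a c).
Proof. by rewrite !mulA (mulC a). Qed.

Let mulAC a b c : mul (mul a b) c = mul (mul a c) b.
Proof. by rewrite -!mulA (mulC b). Qed.

Let lP : linear P. Proof. exact: linearP. Qed.
Let ldl : linear dl. Proof. exact: linearP. Qed.

Ltac expand_linear :=
  by rewrite ?/opL ?/opR /= ?(lP, ldl, mulPr, mulPl, pure_tensorPr, pure_tensorPl).
Ltac lin := move=> ? ? ?; expand_linear.
Ltac bilin := split=> ? ? ? ?; expand_linear.

(** A bilinear expression factors through the tensor product, so antisymmetry of [r] applies inside
    it; in particular it applies to two places of a triple tensor while the other index is held
    fixed. *)
Let sum_swap (W : vectType k) (f : A -> A -> W) : is_bilinear f ->
  \sum_i f (y i) (x i) = - \sum_i f (x i) (y i).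
Proof.
move=> bf; rewrite -(tlift_sum y x bf) -(tlift_sum x y bf) -rE.
have -> : \sum_i (y i ⊗ x i : A ⊗ A) = - r.
  by rewrite -r_antisym rE tau_sum.
exact: linearN.
Qed.

(** The same factorization, applied to [r_shift]. *)
Let sum_shiftl (W : vectType k) (f : A -> A -> W) : is_bilinear f ->
  \sum_i f (P (x i)) (y i) = \sum_i f (x i) (dl (y i)).
Proof.
move=> bf; rewrite -(tlift_sum (fun i => P (x i)) y bf).
rewrite -(tlift_sum x (fun i => dl (y i)) bf); congr tlift.
by have := r_shift; rewrite rE !tmap_sum //; apply: linearP.
Qed.

(** Swapping both sides by antisymmetry reduces this to [sum_shiftl]; the two signs cancel. *)
Let sum_shiftr (W : vectType k) (f : A -> A -> W) : is_bilinear f ->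
  \sum_i f (x i) (P (y i)) = \sum_i f (dl (x i)) (y i).
Proof.
move=> [br bl].
have sw (g : A -> A -> W) : is_bilinear g -> \sum_i g (x i) (y i) = - \sum_i g (y i) (x i).
  by move=> bg; rewrite sum_swap // opprK.
rewrite (sw (fun u v => f u (P v))); last by split=> u c s t; rewrite ?linearP (br, bl).
rewrite (sw (fun u v => f (dl u) v)); last by split=> u c s t; rewrite ?linearP (br, bl).
by congr (- _); apply: (@sum_shiftl W (fun u v => f v u)).
Qed.

(** The Yang-Baxter equation solved for [r13r12], with [F], [G], [H] applied to the three factors.
    The equation enters below only in this form. *)
Let aybe_map (F G H : A -> A) : linear F -> linear G -> linear H ->
  \sum_i \sum_j (F (mul (x i) (x j)) ⊗ G (y j) ⊗ H (y i) : A ⊗ A ⊗ A) =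
  \sum_i \sum_j (F (x i) ⊗ G (mul (y i) (x j)) ⊗ H (y j) : A ⊗ A ⊗ A) -
  \sum_i \sum_j (F (x i) ⊗ G (x j) ⊗ H (mul (y i) (y j)) : A ⊗ A ⊗ A).
Proof.
move=> lF lG lH; apply/eqP; rewrite eq_sym subr_eq eq_sym -subr_eq0; apply/eqP.
have bm := caa_bilinear mul_alg.
have := congr1 (tmap (tmap F G) H) r_aybe.
rewrite (r13r12_sum bm rE) (r13r23_sum bm rE) (r12r23_sum bm rE).
by rewrite linear0 linearB linearD /= !tmap3_sum.
Qed.

(** * The product, the coproduct and their compatibility *)

Let DeltaS a : Delta a =
  \sum_i (mul a (x i) ⊗ P (y i) : A ⊗ A) - \sum_i (x i ⊗ P (mul a (y i)) : A ⊗ A).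
Proof.
by rewrite DeltaE rE !tmap_sum //; lin.
Qed.

Let starE a b : star circ a b = - P (mul a b).
Proof. by rewrite P_star opprK /star !circE. Qed.

Lemma coboundary_novikov_algebra : is_novikov_algebra circ.
Proof.
(* Commutativity equates the expansions of [dl (mul a b)] and [dl (mul b a)]; this makes the
   associator computed next symmetric in [a] and [b]. *)
have dd_sym a b : mul a (dl b) - mul a (dd b) = mul b (dl a) - mul b (dd a).
  apply/eqP; rewrite subr_eq addrAC eq_sym subr_eq [in mul a (dd b)]mulC -dl_mul mulC.
  by rewrite dl_mul (mulC b) eqxx.
have circ_assoc a b c : circ (circ a b) c - circ a (circ b c) =
    mul (mul a (dl b) - mul a (dd b)) (dl c) - mul (mul a b) (dl (dl c)).
  by rewrite !circE dl_mul mulDr mulDl mulNl opprD !mulA addrA addrAC.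
split=> [|a b c|a b c].
- by split=> u c s t; rewrite !circE ?linearP ?mulPr ?mulPl.
- by rewrite !circ_assoc dd_sym (mulC a b).
- by rewrite !circE mulAC.
Qed.

Lemma coboundary_linear : linear Delta.
Proof.
move=> c s t; rewrite !DeltaS scalerBr !scaler_sumr.
rewrite addrACA -opprD -!big_split.
by congr (_ - _); apply: eq_bigr => i _ /=; rewrite mulPl ?linearP ?pure_tensorPl.
Qed.

Let linear_star a : linear (opL (star circ) a).
Proof. by move=> c s t; rewrite /opL !starE mulPr linearP scalerN -opprD. Qed.

Let linear_opR a : linear (opR circ a).
Proof. by move=> c s t; rewrite /opR !circE mulPl. Qed.

(** Antisymmetry restores the order [x i], [y i] after the flip, and the shift then moves [P] off
    the first factor of one term. *)
Let tau_DeltaS a : tau (Delta a) =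
  \sum_i (P (mul a (x i)) ⊗ y i : A ⊗ A) - \sum_i (x i ⊗ mul a (dl (y i)) : A ⊗ A).
Proof.
rewrite DeltaS linearB /= !tau_sum.
rewrite (sum_swap (f := fun u v => P u ⊗ mul a v)); last bilin.
rewrite (sum_swap (f := fun u v => P (mul a u) ⊗ v)); last bilin.
rewrite opprK addrC (sum_shiftl (f := fun u v => u ⊗ mul a v)) //.
bilin.
Qed.

(** The right-hand side is [delta_r mul r (dl a)]: once [P] of a product is expanded, the terms with
    [dl] acting on [x i] or [y i] cancel. *)
Let symDeltaS a : Delta a + tau (Delta a) =
  \sum_i (x i ⊗ mul (dl a) (y i) : A ⊗ A) - \sum_i (mul (dl a) (x i) ⊗ y i : A ⊗ A).
Proof.
have PN b c : P (mul b c) = - mul b (dl c) - mul (dl b) c.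
  by rewrite P_star opprD (mulC c).
rewrite tau_DeltaS DeltaS (sum_shiftr (f := fun u v => mul a u ⊗ v)); last first.
  bilin.
rewrite -!sumrB -big_split; apply: eq_bigr => i _ /=.
rewrite addrACA -opprD -pure_tensorDl -pure_tensorDr !PN.
by rewrite addrA subrr add0r addrAC addNr add0r pure_tensorNl pure_tensorNr opprK addrC.
Qed.

(** Identifies the coboundary coproduct: [sum_shiftr] trades [dl] on the first factor for [P] on the
    second, and [starE] gives the other term. *)
Lemma coboundary_coproductE a :
  tmap (opL circ a) id r + tmap id (opL (star circ) a) r = Delta a.
Proof.
have lc : linear (opL circ a).
  by move=> c s t; rewrite /opL !circE linearP mulPr.
rewrite DeltaS rE !tmap_sum // (sum_shiftr (f := fun u v => mul a u ⊗ v)); last first.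
  bilin.
rewrite -sumrN; congr (_ + _); apply: eq_bigr => i _; first by rewrite /opL circE.
by rewrite /opL starE pure_tensorNr.
Qed.

(** The only terms not already in [Delta (circ a b)] are two copies of
    [mul (dl b) (x i) ⊗ P (mul a (y i))] with opposite signs. *)
Lemma coboundary_compat1 a b : Delta (circ a b) =
  tmap (opR circ b) id (Delta a)
  + tmap id (opL (star circ) a) (Delta b + tau (Delta b)).
Proof.
rewrite symDeltaS !DeltaS !linearB /=.
rewrite !tmap_sum //; try by [exact: linear_opR | exact: linear_star].
rewrite /opL /opR -!sumrB -big_split; apply: eq_bigr => i _ /=.
rewrite !circE !starE !pure_tensorNr opprK !mulA (mulC (x i)) (mulAC a (x i)).
by rewrite addrACA addNr addr0.
Qed.

(** Each side consists of two terms in which [a] and [b] are multiplied together, plus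
    [P (mul a (x i)) ⊗ P (mul b (y i))] and its counterpart with [a] and [b] exchanged. *)
Lemma coboundary_compat2 a b :
  tmap (opL (star circ) a) id (Delta b)
    - tmap id (opL (star circ) a) (tau (Delta b))
  = tmap (opL (star circ) b) id (Delta a)
    - tmap id (opL (star circ) b) (tau (Delta a)).
Proof.
rewrite !tau_DeltaS !DeltaS !linearB /=.
rewrite !tmap_sum //; try exact: linear_star.
rewrite /opL -!sumrN -!big_split; apply: eq_bigr => i _ /=.
rewrite !starE !pure_tensorNr !pure_tensorNl !(mulCA a b) ?opprD ?opprK !addrA.
by congr (_ - _); rewrite addrAC.
Qed.

(** By [symDeltaS] both sides apply to [r] the operators id ⊗ L(c) - L(c) ⊗ id for c = [dl a] and c
    = [dl b], and these commute. *)
Lemma coboundary_compat3 a b :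
  tmap id (opR circ a) (Delta b + tau (Delta b))
    - tmap (opR circ a) id (Delta b + tau (Delta b))
  = tmap id (opR circ b) (Delta a + tau (Delta a))
    - tmap (opR circ b) id (Delta a + tau (Delta a)).
Proof.
rewrite !symDeltaS !linearB /=.
rewrite !tmap_sum //; try exact: linear_opR.
rewrite /opR -!sumrN -!big_split; apply: eq_bigr => i _ /=.
rewrite !circE !(mulC _ (dl a)) !(mulC _ (dl b)) !(mulCA (dl a)).
by rewrite ?opprD ?opprK !addrA; congr (_ + _); rewrite addrAC.
Qed.

(** * The coalgebra axioms, by expansion into triple tensors *)

Local Notation triple u v w := (u ⊗ v ⊗ w : A ⊗ A ⊗ A).

Let tassoc_DeltaS u w : tassoc (u ⊗ Delta w) =
  \sum_j triple u (mul w (x j)) (P (y j)) - \sum_j triple u (x j) (P (mul w (y j))).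
Proof.
rewrite DeltaS pure_tensorDr pure_tensorNr !pure_tensor_sumr linearB /=.
by congr (_ - _); rewrite linear_sum; apply: eq_bigr => j _; rewrite /= tassoc_pure.
Qed.

Let Delta_tensorS u w : Delta u ⊗ w =
  \sum_j triple (mul u (x j)) (P (y j)) w - \sum_j triple (x j) (P (mul u (y j))) w.
Proof.
by rewrite DeltaS pure_tensorDl pure_tensorNl !pure_tensor_suml.
Qed.

Let tassoc_Delta_sum (u w : 'I_n -> A) :
  tassoc (tmap id Delta (\sum_i (u i ⊗ w i : A ⊗ A))) =
  \sum_i \sum_j triple (u i) (mul (w i) (x j)) (P (y j)) -
  \sum_i \sum_j triple (u i) (x j) (P (mul (w i) (y j))).
Proof.
rewrite tmap_sum //; last exact: coboundary_linear.
by rewrite linear_sum -sumrB; apply: eq_bigr => i _; apply: tassoc_DeltaS.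
Qed.

Let Delta_tmap_sum (u w : 'I_n -> A) :
  tmap Delta id (\sum_i (u i ⊗ w i : A ⊗ A)) =
  \sum_i \sum_j triple (mul (u i) (x j)) (P (y j)) (w i) -
  \sum_i \sum_j triple (x j) (P (mul (u i) (y j))) (w i).
Proof.
rewrite tmap_sum //; last exact: coboundary_linear.
by rewrite -sumrB; apply: eq_bigr => i _; apply: Delta_tensorS.
Qed.

Let tau12_sum (u v w : 'I_n -> 'I_n -> A) :
  tmap (@tau k A A) id (\sum_i \sum_j triple (u i j) (v i j) (w i j)) =
  \sum_i \sum_j triple (v i j) (u i j) (w i j).
Proof.
rewrite linear_sum; apply: eq_bigr => i _ /=.
rewrite tmap_sum //; last exact: linearP.
by apply: eq_bigr => j _; rewrite tau_pure.
Qed.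

Let coassocS a : tassoc (tmap id Delta (Delta a)) =
  \sum_i \sum_j triple (mul a (x i)) (mul (P (y i)) (x j)) (P (y j))
  - \sum_i \sum_j triple (mul a (x i)) (x j) (P (mul (P (y i)) (y j)))
  - (\sum_i \sum_j triple (x i) (mul (P (mul a (y i))) (x j)) (P (y j))
     - \sum_i \sum_j triple (x i) (x j) (P (mul (P (mul a (y i))) (y j)))).
Proof.
by rewrite [Delta a]DeltaS [tmap _ _ _]linearB [tassoc _]linearB /= !tassoc_Delta_sum.
Qed.

Let Delta_tmapS a : tmap Delta id (Delta a) =
  \sum_i \sum_j triple (mul (mul a (x i)) (x j)) (P (y j)) (P (y i))
  - \sum_i \sum_j triple (x j) (P (mul (mul a (x i)) (y j))) (P (y i))
  - (\sum_i \sum_j triple (mul (x i) (x j)) (P (y j)) (P (mul a (y i)))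
     - \sum_i \sum_j triple (x j) (P (mul (x i) (y j))) (P (mul a (y i)))).
Proof. by rewrite [Delta a]DeltaS [tmap _ _ _]linearB /= !Delta_tmap_sum. Qed.

(** In the Yang-Baxter equation mapped by [id], [P] and [P \o mul a], the [r12r23] term is the sum
    subtracted on the left with [i] and [j] exchanged; only [r13r23] survives. *)
Let aybe_tail a :
  \sum_i \sum_j triple (mul (x i) (x j)) (P (y j)) (P (mul a (y i)))
  - \sum_i \sum_j triple (x j) (P (mul (x i) (y j))) (P (mul a (y i)))
  = - \sum_i \sum_j triple (x i) (P (x j)) (P (mul a (mul (y i) (y j)))).
Proof.
have lPa : linear (P \o mul a) by lin.
rewrite (aybe_map (F := id) (G := P) (H := P \o mul a)) //.
rewrite [X in _ - X]exchange_big /= addrAC -[RHS]add0r; congr (_ - _).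
apply/eqP; rewrite subr_eq0; apply/eqP.
by apply: eq_bigr => i _; apply: eq_bigr => j _; rewrite (mulC (x j)).
Qed.

(** The left side expands into four sums. The first is relabelled, the second is swapped by
    antisymmetry, and the third is rewritten by the Yang-Baxter equation with [P \o mul a] in the
    middle; the extra term so produced cancels the fourth. *)
Lemma coboundary_right_comm a :
  tmap (@tau k A A) id (tassoc (tmap id Delta (tau (Delta a)))) =
  tmap Delta id (Delta a).
Proof.
rewrite Delta_tmapS aybe_tail opprK.
rewrite [Delta a]DeltaS [tau _]linearB /= !tau_sum [tmap id _ _]linearB [tassoc _]linearB.
rewrite /= !tassoc_Delta_sum !linearB /= !tau12_sum.
have lPa : linear (P \o mul a) by lin.
have e1 : \sum_i \sum_j triple (mul (mul a (x i)) (x j)) (P (y i)) (P (y j)) =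
          \sum_i \sum_j triple (mul (mul a (x i)) (x j)) (P (y j)) (P (y i)).
  by rewrite exchange_big; do 2![apply: eq_bigr => ? _ /=]; rewrite mulAC.
have e2 : \sum_i \sum_j triple (x j) (P (y i)) (P (mul (mul a (x i)) (y j))) =
        - \sum_i \sum_j triple (x i) (P (x j)) (P (mul a (mul (y i) (y j)))).
  rewrite exchange_big -sumrN; apply: eq_bigr => j _ /=.
  rewrite (sum_swap (f := fun u v => triple (x j) (P u) (P (mul (mul a v) (y j))))).
    by congr (- _); apply: eq_bigr => i _; rewrite -mulA (mulC (y i)).
  bilin.
have e3 : \sum_i \sum_j triple (mul (x i) (x j)) (P (mul a (y i))) (P (y j)) =
    \sum_i \sum_j triple (x j) (P (mul (mul a (x i)) (y j))) (P (y i))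
    + \sum_i \sum_j triple (x j) (P (mul a (y i))) (P (mul (x i) (y j))).
  transitivity (\sum_i \sum_j triple (mul (x i) (x j)) (P (mul a (y j))) (P (y i))).
    by rewrite exchange_big; do 2![apply: eq_bigr => ? _ /=]; rewrite mulC.
  rewrite (aybe_map (F := id) (G := P \o mul a) (H := P)) //=.
  congr (_ + _).
    rewrite exchange_big; do 2![apply: eq_bigr => ? _ /=].
    by rewrite (mulC (y _)) mulA.
  rewrite -sumrN [RHS]exchange_big; apply: eq_bigr => i _ /=.
  rewrite (sum_swap (f := fun u v => triple (x i) (P (mul a u)) (P (mul v (y i))))).
    by congr (- _); apply: eq_bigr => j _; rewrite (mulC (y j)).
  bilin.
by rewrite e1 e2 e3 !opprK opprD subrK addrAC.
Qed.

Lemma coboundary_left_symmetric a :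
  let t := tassoc (tmap id Delta (Delta a)) in
  let s := tmap Delta id (Delta a) in
  t - tmap (@tau k A A) id t = s - tmap (@tau k A A) id s.
Proof.
move=> t s.
(* It suffices that t - s is invariant under the flip of the first two factors;
   it is the sum of U, of its flip, and of an invariant tail. *)
suff sym : tmap (@tau k A A) id (t - s) = t - s.
  move: sym; rewrite linearB /= => sym.
  by apply/eqP; rewrite subr_eq -addrA [- _ + _]addrC sym addrCA subrr addr0.
(* [U] collects the [dd] part of [dl (mul (x i) (x j))]. *)
pose U := \sum_i \sum_j triple (mul a (mul (dd (x i)) (x j))) (y j) (P (y i)).
have lPa : linear (P \o mul a) by lin.
have lad : linear (mul a \o dl) by lin.
(* Both occurrences of [P (y i)] become [dl (x i)]. The Yang-Baxter equation then merges the sums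
   into one containing [dl (mul (x i) (x j))], which [dl_mul] splits. *)
have e1 : \sum_i \sum_j triple (mul a (x i)) (mul (P (y i)) (x j)) (P (y j))
    - \sum_i \sum_j triple (mul a (x i)) (x j) (P (mul (P (y i)) (y j)))
    = \sum_i \sum_j triple (mul (mul a (x i)) (x j)) (P (y j)) (P (y i)) + U.
  have -> : \sum_i \sum_j triple (mul a (x i)) (mul (P (y i)) (x j)) (P (y j)) =
      \sum_i \sum_j triple (mul a (dl (x i))) (mul (y i) (x j)) (P (y j)).
    rewrite exchange_big [RHS]exchange_big; apply: eq_bigr => j _ /=.
    apply: (sum_shiftr (f := fun u v => triple (mul a u) (mul v (x j)) (P (y j)))).
    bilin.
  have -> : \sum_i \sum_j triple (mul a (x i)) (x j) (P (mul (P (y i)) (y j))) =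
      \sum_i \sum_j triple (mul a (dl (x i))) (x j) (P (mul (y i) (y j))).
    rewrite exchange_big [RHS]exchange_big; apply: eq_bigr => j _ /=.
    apply: (sum_shiftr (f := fun u v => triple (mul a u) (x j) (P (mul v (y j))))).
    bilin.
  rewrite -(aybe_map (F := mul a \o dl) (G := id) (H := P)) //=.
  rewrite -big_split; apply: eq_bigr => i _ /=.
  rewrite (sum_shiftr (f := fun u v => triple (mul (mul a (x i)) u) v (P (y i)))).
    rewrite -big_split; apply: eq_bigr => j _ /=.
    by rewrite -mulA dl_mul mulDr !pure_tensorDl.
  bilin.
(* By [P_mul], pulling [x j] into [P] costs a [dd] term, which antisymmetry identifies with minus
   the flip of [U]. *)
have e2 : \sum_i \sum_j triple (x i) (mul (P (mul a (y i))) (x j)) (P (y j)) =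
    \sum_i \sum_j triple (x j) (P (mul (mul a (x i)) (y j))) (P (y i))
    - tmap (@tau k A A) id U.
  rewrite /U tau12_sum exchange_big -sumrB; apply: eq_bigr => j _ /=.
  rewrite (sum_swap (f := fun u v => triple u (mul a (mul (dd (x j)) v)) (P (y j)))).
    rewrite opprK -big_split; apply: eq_bigr => i _ /=.
    rewrite -pure_tensorDl -pure_tensorDr (mulAC a (x j)) (P_mul (mul a (y i))).
    by rewrite (mulC (dd _)) (mulA a) subrK.
  bilin.
have sym_tail : tmap (@tau k A A) id
     (\sum_i \sum_j triple (x i) (x j) (P (mul (P (mul a (y i))) (y j)))
       - \sum_i \sum_j triple (x i) (P (x j)) (P (mul a (mul (y i) (y j))))) =
     \sum_i \sum_j triple (x i) (x j) (P (mul (P (mul a (y i))) (y j)))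
       - \sum_i \sum_j triple (x i) (P (x j)) (P (mul a (mul (y i) (y j)))).
  have -> : \sum_i \sum_j triple (x i) (P (x j)) (P (mul a (mul (y i) (y j)))) =
            \sum_i \sum_j triple (x i) (x j) (P (mul a (mul (y i) (dl (y j))))).
    apply: eq_bigr => i _.
    apply: (sum_shiftl (f := fun u v => triple (x i) u (P (mul a (mul (y i) v))))).
    bilin.
  (* After a shift the tail is the sum of [triple (x i) (x j) (P (h i j))]. Since [P_star] makes [h]
     symmetric, the flip amounts to relabelling. *)
  pose h i j := mul (P (mul a (y i))) (y j) - mul a (mul (y i) (dl (y j))).
  have hE i j : h i j = - (mul a (mul (y j) (dl (y i)))
      + mul (mul (y i) (y j)) (dl a) + mul a (mul (y i) (dl (y j)))).
    by rewrite /h P_star mulNl mulDl -opprD -mulA (mulC (dl _)) (mulAC (y i)).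
  have hC i j : h i j = h j i.
    by rewrite !hE (mulC (y j) (y i)) addrAC [in RHS]addrAC (addrC (mul a _)).
  have -> : \sum_i \sum_j triple (x i) (x j) (P (mul (P (mul a (y i))) (y j)))
      - \sum_i \sum_j triple (x i) (x j) (P (mul a (mul (y i) (dl (y j)))))
      = \sum_i \sum_j triple (x i) (x j) (P (h i j)).
    rewrite -sumrB; apply: eq_bigr => i _; rewrite -sumrB; apply: eq_bigr => j _.
    by rewrite -pure_tensorNr -pure_tensorDr /h [P (_ - _)]linearB.
  rewrite tau12_sum exchange_big; apply: eq_bigr => i _; apply: eq_bigr => j _ /=.
  by rewrite hC.
(* [B1] and [B2] are the sums shared by [t] and [s], [V1] and [V2] are [U] and its flip, and
   [C1 - C2] is the tail. *)
have cancel (B1 B2 V1 V2 C1 C2 : (A ⊗ A ⊗ A)%type) :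
    B1 + V1 - (B2 - V2 - C1) - (B1 - B2 + C2) = V1 + V2 + (C1 - C2).
  rewrite !opprD !opprK !addrA [LHS](ACl (2*4*5*8*(1*6)*(3*7))%AC) /=.
  by rewrite subrr addNr !addr0.
have tauK : tmap (@tau k A A) id (tmap (@tau k A A) id U) = U.
  by rewrite /U !tau12_sum.
rewrite /t /s coassocS Delta_tmapS e1 e2 aybe_tail opprK cancel.
by rewrite linearD /= sym_tail linearD /= tauK (addrC U).
Qed.

Lemma coboundary_novikov_bialgebra : is_novikov_bialgebra circ Delta.
Proof.
split.
- exact: coboundary_novikov_algebra.
- split; [exact: coboundary_linear | exact: coboundary_left_symmetric |].
  exact: coboundary_right_comm.
- exact: coboundary_compat1.
- exact: coboundary_compat2.
- exact: coboundary_compat3.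
Qed.

End CoboundaryBialgebra.

(** * Specialization to the Novikov algebra induced by [D] and [Q] *)

Section Induced.

Variables (k : fieldType) (A : vectType k) (mul : A -> A -> A) (D Q : A -> A).
Hypothesis adm : is_adm_comm_diff_algebra mul D Q.
Variable r : A ⊗ A.
Hypothesis aybe : is_adm_aybe_solution mul D Q r.
Hypothesis antisym : is_antisymmetric_tensor r.
Variable q : k.
Hypothesis QD_mul : forall a b, (1 + q *+ 2) *: mul (Q a + D a) b = 0.

Let lD : linear D := acda_D_linear adm.
Let lQ : linear Q := acda_Q_linear adm.
Let lP : linear (fun b => Q b + q *: D b).
Proof.
by move=> c s t; rewrite lD lQ !scalerDr addrACA !scalerA [q * c]mulrC.
Qed.
Let ldl : linear (fun b => D b + q *: Q b).
Proof.
by move=> c s t; rewrite lD lQ !scalerDr addrACA !scalerA [q * c]mulrC.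
Qed.
Let ldd : linear (fun b => (1 - q) *: D b).
Proof. by move=> c s t; rewrite lD scalerDr !scalerA [_ * c]mulrC. Qed.

Let P : {linear A -> A} := HB.pack (fun b => Q b + q *: D b)
  (GRing.isLinear.Build k A A *:%R _ lP).
Let dl : {linear A -> A} := HB.pack (fun b => D b + q *: Q b)
  (GRing.isLinear.Build k A A *:%R _ ldl).
Let dd : {linear A -> A} := HB.pack (fun b => (1 - q) *: D b)
  (GRing.isLinear.Build k A A *:%R _ ldd).

Let mul_alg : is_comm_assoc_algebra mul := acda_algebra adm.
Let mulC : commutative mul := caa_comm mul_alg.
Let mulPr a : linear (mul a).
Proof. by case: (caa_bilinear mul_alg). Qed.
Let mulDr a b c : mul a (b + c) = mul a b + mul a c.
Proof. by have := mulPr a 1 b c; rewrite !scale1r. Qed.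
Let mulZr c a b : mul a (c *: b) = c *: mul a b.
Proof.
have mul0 : mul a 0 = 0 by apply: (addrI (mul a 0)); rewrite -mulDr !addr0.
by have := mulPr a c b 0; rewrite mul0 !addr0.
Qed.

Let D_mul := acda_D_derivation adm.
Let Q_mul := acda_Q_admissible adm.

Lemma induced_P_mul a b : P (mul a b) = mul (P a) b - mul a (dd b).
Proof.
rewrite /= Q_mul D_mul (mulC (_ + _)) mulDr !mulZr !(mulC b).
by rewrite scalerBl scale1r opprB scalerDr addrACA [- _ + _]addrC.
Qed.

Lemma induced_dl_mul a b : dl (mul a b) = mul a (dl b) + mul (dd a) b.
Proof.
(* Admissibility is applied to [mul b a], so that [Q] falls on [b] and [D] on [a]. *)
rewrite /= D_mul (mulC a b) Q_mul (mulC (_ *: _)) mulDr !mulZr !(mulC b).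
by rewrite scalerBl scale1r scalerBr [mul (D a) b + _]addrC addrACA (mulC (Q b)).
Qed.

Lemma induced_P_star a b : P (mul a b) = - (mul a (dl b) + mul b (dl a)).
Proof.
(* Comparing [Q (mul a b)] with [Q (mul b a)] moves [Q + D] from one factor to the other. The sum to
   be killed then becomes the left side of [QD_mul]. *)
have swap : mul a (D b) + mul a (Q b) = mul (Q a) b + mul (D a) b.
  have e : mul (Q a) b - mul a (D b) = mul a (Q b) - mul (D a) b.
    by rewrite -Q_mul (mulC a b) Q_mul (mulC b) (mulC _ a).
  have -> : mul a (Q b) = mul (Q a) b - mul a (D b) + mul (D a) b.
    by rewrite e subrK.
  by rewrite addrA (addrC (mul a (D b))) subrK.
apply/eqP; rewrite -addr_eq0 /= Q_mul D_mul !mulDr !mulZr !(mulC b).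
rewrite -(QD_mul a b) (mulC (_ + _)) mulDr !(mulC b) scalerDl scale1r -scalerMnl.
rewrite [X in _ + X]addrACA -scalerDr addrACA -scalerDr (addrA _ (mul a (D b))) subrK.
rewrite [mul (D a) b + _ + _](AC (2*2) ((2*3)*(4*1)))%AC /= swap.
by rewrite scalerMnr mulr2n.
Qed.

Lemma induced_bialgebras :
  [/\ is_novikov_bialgebra (circq mul D Q q) (Delta_qr mul D Q q r),
      is_novikov_bialgebra (circq mul D Q q) (Delta_q mul D Q q r)
    & Delta_qr mul D Q q r =1 Delta_q mul D Q q r].
Proof.
have [x [y rE]] := tensor_decomposition r.
(* The two relations exchange [Q] on the left with [D] on the right, and [D] on the left with [Q] on
   the right; the shift is their combination with weights 1 and [q]. *)
have shift : tmap P id r = tmap id dl r.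
  have DQ : tmap D id r = tmap id Q r by apply: subr0_eq; apply: aybe_DQ aybe.
  have QD : tmap id D r = tmap Q id r by apply: subr0_eq; apply: aybe_QD aybe.
  have -> : tmap P id r = tmap Q id r + q *: tmap D id r.
    rewrite rE !tmap_sum //.
    rewrite scaler_sumr -big_split; apply: eq_bigr => i _ /=.
    by rewrite [Q _ + _]addrC pure_tensorPl addrC.
  rewrite DQ -QD rE !tmap_sum //.
  rewrite scaler_sumr -big_split; apply: eq_bigr => i _ /=.
  by rewrite [D _ + _]addrC pure_tensorPr addrC.
have DeltaE a : Delta_q mul D Q q r a =
    tmap (mul a) P r - tmap id (fun b => P (mul a b)) r.
  have lPa : linear (fun b => P (mul a b)).
    by move=> c s t; rewrite mulPr linearP.
  rewrite /Delta_q /delta_r rE !tmap_sum // linearB /= !tmap_sum //.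
  by rewrite opprB.
have aybeE : r13r12 mul r + r13r23 mul r - r12r23 mul r = 0 := aybe_eq aybe.
have coproductE : Delta_qr mul D Q q r =1 Delta_q mul D Q q r.
  by move=> a; apply: (coboundary_coproductE mul_alg induced_P_star rE).
have bialgebra := coboundary_novikov_bialgebra mul_alg induced_P_mul
  induced_dl_mul induced_P_star rE antisym aybeE shift.
have circE a b : circq mul D Q q a b = mul a (dl b) by [].
by split; [apply: (bialgebra _ _ circE) => a; rewrite coproductE DeltaE
         | exact: (bialgebra _ _ circE DeltaE) |].
Qed.

End Induced.

Theorem proposition3p5 (k : fieldType) (char0 : [pchar k] =i pred0)
    (A : vectType k) (mul : A -> A -> A) (D Q : A -> A)
    (adm : is_adm_comm_diff_algebra mul D Q)
    (r : A ⊗ A)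
    (aybe : is_adm_aybe_solution mul D Q r)
    (antisym : is_antisymmetric_tensor r) :
  [/\ is_novikov_bialgebra (circq mul D Q (- 2^-1))
        (Delta_qr mul D Q (- 2^-1) r),
      is_novikov_bialgebra (circq mul D Q (- 2^-1))
        (Delta_q mul D Q (- 2^-1) r)
    & Delta_qr mul D Q (- 2^-1) r =1 Delta_q mul D Q (- 2^-1) r]
  /\
  (is_derivation mul Q ->
   forall q : k,
     [/\ is_novikov_bialgebra (circq mul D Q q) (Delta_qr mul D Q q r),
         is_novikov_bialgebra (circq mul D Q q) (Delta_q mul D Q q r)
       & Delta_qr mul D Q q r =1 Delta_q mul D Q q r]).
Proof.
split=> [|Qder q]; apply: (induced_bialgebras adm aybe antisym) => a b.
  (* Characteristic 0 makes 2 invertible, so 1 + 2q vanishes at q = -1/2. *)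
  have two_neq0 : 2 != 0 :> k by have [/(_ char0) ->] := pcharf0P k.
  by rewrite mulNrn -[2^-1 *+ 2]mulr_natr mulVf // subrr scale0r.
have mul_alg := acda_algebra adm.
have mulC := caa_comm mul_alg.
have mulDr c u v : mul c (u + v) = mul c u + mul c v.
  by have [mulPr _] := caa_bilinear mul_alg; have := mulPr c 1 u v; rewrite !scale1r.
(* The Leibniz rule and admissibility give two expansions of [Q (mul b a)]; they differ only in
   these terms. *)
have QN : mul b (Q a) = - mul b (D a).
  by apply: (addrI (mul (Q b) a)); rewrite -Qder (acda_Q_admissible adm).
by rewrite mulC mulDr QN addNr scaler0.
Qed.
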